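(* Let $f,g\in\mathbb{R}^N$ be signals on the point cloud and let $\langle f,g\rangle_B:=f^\top Bg$. For any $\alpha\in\mathbb{R}$, $$\bigl\langle\hat f^{(\alpha)},\hat g^{(\alpha)}\bigr\rangle=\langle f,g\rangle_B,$$ and in particular $\bigl\|\hat f^{(\alpha)}\bigr\|_2^2=f^\top Bf$.
   Context: Discrete Laplace–Beltrami data. Let $P=\{p_1,\dots,p_N\}\subset\mathbb{R}^3$ be a point cloud sampled from a surface and let $t>0$. For each $i$, let $\hat T_{p_i}$ be the estimated tangent plane at $p_i$ (best-fitting plane to the points of $P$ in a ball around $p_i$), and let $b_{ii}>0$ be the area of the Voronoi cell of $p_i$ in the planar Voronoi diagram, on $\hat T_{p_i}$, of the projections of the points of $P$ in a ball $B(p_i,\delta)$. Let $B=\mathrm{diag}(b_{11},\dots,b_{NN})$ (mass matrix) and let $Q$ be the real symmetric matrix with $q_{ij}=\frac{b_{ii}b_{jj}}{4\pi t^2}\exp(-\|p_i-p_j\|^2/(4t))$ for $i\ne j$ and $q_{ii}=-\sum_{j\neq i}q_{ij}$. Let $H\in\mathbb{R}^{N\times N}$ be a matrix whose columns $H_i$ are generalized eigenvectors, $QH_i=-\lambda_i BH_i$, normalized so that $H^\top BH=I$. Fractional transform. Put $F_M:=H^\top B^{1/2}$, a real orthogonal matrix. Fix a spectral decomposition $F_M=V\Omega V^*$ with $V$ unitary and $\Omega=\mathrm{diag}(\omega_1,\dots,\omega_N)$, $|\omega_i|=1$. For $\alpha\in\mathbb{R}$ put $F_M^{(\alpha)}:=V\Omega^\alpha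 V^*$ with $\Omega^\alpha=\mathrm{diag}(\omega_1^\alpha,\dots,\omega_N^\alpha)$, where $\omega_i^\alpha:=e^{\mathrm{i}\alpha\theta_i}$ for a choice of real argument $\theta_i$ of $\omega_i$ fixed once for all $\alpha$. The point cloud manifold fractional harmonic transform (PMFHT) of order $\alpha$ of a signal $f$ is $\hat f^{(\alpha)}:=F_M^{(\alpha)}(B^{1/2}f)\in\mathbb{C}^N$. On $\mathbb{C}^N$, $\langle u,v\rangle=u^*v$ is the standard Hermitian inner product. *)

(* Defs.v *)
From HB Require Import structures.
From mathcomp Require Import all_boot all_order all_algebra.
From mathcomp Require Import all_classical all_reals all_analysis.
From mathcomp Require Import complex.

Set Implicit Arguments.
Unset Strict Implicit.
Unset Printing Implicit Defensive.

Import Order.TTheory GRing.Theory Num.Theory.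

Local Open Scope classical_set_scope.
Local Open Scope ring_scope.
Local Open Scope complex_scope.
Local Open Scope sesquilinear_scope.

Section Geometry.
Variable R : realType.
Implicit Types u v x : 'rV[R]_3.

Definition edot u v : R := \sum_k u 0 k * v 0 k.

(* The Euclidean norm; the library norm [`|v|] on ['rV[R]_3] is the sup norm. *)
Definition enorm v : R := Num.sqrt (edot v v).

(* An affine plane of R^3, given by an orthonormal affine frame of it.  All the
   notions below depend only on the plane, not on the frame. *)
Record plane := Plane {
  origin : 'rV[R]_3;
  dir1 : 'rV[R]_3;
  dir2 : 'rV[R]_3;
  dir1_unit : edot dir1 dir1 = 1;
  dir2_unit : edot dir2 dir2 = 1;
  dir_orth : edot dir1 dir2 = 0 }.

Definition plane_point (T : plane) (a : R * R) : 'rV[R]_3 :=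
  origin T + a.1 *: dir1 T + a.2 *: dir2 T.

Definition proj (T : plane) x : 'rV[R]_3 :=
  plane_point T (edot (x - origin T) (dir1 T), edot (x - origin T) (dir2 T)).

Definition plane_area (T : plane) (S : set 'rV[R]_3) : \bar R :=
  (@lebesgue_measure R \x @lebesgue_measure R)%E (plane_point T @^-1` S).

Variables (N : nat) (p : 'I_N -> 'rV[R]_3).

Definition in_ball (i : 'I_N) (r : R) (j : 'I_N) : bool :=
  enorm (p j - p i) < r.

Definition fit_error (i : 'I_N) (r : R) (T : plane) : R :=
  \sum_(j < N | in_ball i r j) enorm (p j - proj T (p j)) ^+ 2.

(* Best fitting in the (total) least squares sense. *)
Definition best_fitting (i : 'I_N) (r : R) (T : plane) : Prop :=
  forall T' : plane, fit_error i r T <= fit_error i r T'.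

Definition voronoi_cell (i : 'I_N) (delta : R) (T : plane) : set 'rV[R]_3 :=
  [set x | range (plane_point T) x /\
    forall j : 'I_N, in_ball i delta j ->
      enorm (x - proj T (p i)) <= enorm (x - proj T (p j))].

Definition voronoi_area (i : 'I_N) (delta : R) (T : plane) : \bar R :=
  plane_area T (voronoi_cell i delta T).

Definition mass_matrix (b : 'I_N -> R) : 'M[R]_N := diag_mx (\row_i b i).

Definition sqrt_mass_matrix (b : 'I_N -> R) : 'M[R]_N :=
  diag_mx (\row_i Num.sqrt (b i)).

Definition lb_weight (t : R) (b : 'I_N -> R) (i j : 'I_N) : R :=
  b i * b j / (4 * pi * t ^+ 2) * expR (- (enorm (p i - p j) ^+ 2 / (4 * t))).

Definition lb_matrix (t : R) (b : 'I_N -> R) : 'M[R]_N :=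
  \matrix_(i, j) if i == j then - \sum_(k < N | k != i) lb_weight t b i k
                 else lb_weight t b i j.

End Geometry.

Section Transform.
Variables (R : realType) (N : nat).

Definition expi (x : R) : R[i] := cos x +i* sin x.

Definition complexify m n (A : 'M[R]_(m, n)) : 'M[R[i]]_(m, n) :=
  map_mx (real_complex R) A.

Definition harmonic_matrix (b : 'I_N -> R) (H : 'M[R]_N) : 'M[R]_N :=
  H^T *m sqrt_mass_matrix b.

(* [theta] is the chosen family of arguments of the eigenvalues, so that
   [expi (alpha * theta i)] is the power of order [alpha] of the i-th one. *)
Definition fractional_matrix (V : 'M[R[i]]_N) (theta : 'I_N -> R) (alpha : R) :
    'M[R[i]]_N :=
  V *m diag_mx (\row_i expi (alpha * theta i)) *m V ^t*.

Definition pmfht (b : 'I_N -> R) (V : 'M[R[i]]_N) (theta : 'I_N -> R)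
    (alpha : R) (f : 'cV[R]_N) : 'cV[R[i]]_N :=
  fractional_matrix V theta alpha *m complexify (sqrt_mass_matrix b *m f).

Definition hermitian_dot (u v : 'cV[R[i]]_N) : R[i] := (u ^t* *m v) 0 0.

Definition l2norm (u : 'cV[R[i]]_N) : R :=
  Num.sqrt (\sum_i ComplexField.Normc.normc (u i 0) ^+ 2).

Definition mass_dot (b : 'I_N -> R) (f g : 'cV[R]_N) : R :=
  (f^T *m mass_matrix b *m g) 0 0.

End Transform.

(* Main.v *)
Require Import Defs.
From HB Require Import structures.
From mathcomp Require Import all_boot all_order all_algebra.
From mathcomp Require Import all_classical all_reals all_analysis.
From mathcomp Require Import complex.

Set Implicit Arguments.
Unset Strict Implicit.
Unset Printing Implicit Defensive.

Import Order.TTheory GRing.Theory Num.Theory.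

Local Open Scope ring_scope.
Local Open Scope complex_scope.
Local Open Scope sesquilinear_scope.

(** The transform of a signal [f] is obtained by the isometric rescaling
    [f |-> B^(1/2) f], which turns the mass inner product into the standard
    one because [B^(1/2)] is symmetric with square [B], followed by the
    fractional matrix [V Omega^alpha V^*].  The latter is unitary for every
    real [alpha]: real multiples of the real arguments [theta k] give
    eigenvalues [expi (alpha * theta k)] on the unit circle
    ([fractional_matrix_unitary]), and a unitary matrix preserves the Hermitian
    product ([hermitian_dot_unitary]).  On real vectors the Hermitian product
    is the ordinary dot product, so the inner product of two transforms is
    [(B^(1/2) f)^T (B^(1/2) g) = f^T B g] ([pmfht_parseval]).  The norm identity
    is the case [f = g], since the Hermitian product of a vector with itself is
    its squared norm. *)

Section Hermitian.
Variables (R : realType) (N : nat).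
Implicit Types (U V : 'M[R[i]]_N) (u v : 'cV[R[i]]_N).

Lemma expi_mul_conj (x : R) : expi x * Num.conj (expi x) = 1.
Proof.
apply/eqP; rewrite /expi eq_complex /= mulrN opprK -!expr2 cos2Dsin2.
by rewrite mulrN mulrC addNr !eqxx.
Qed.

(** The phases [alpha * theta k] are real, so the diagonal factor has entries of
    modulus one and all three factors are unitary. *)
Lemma fractional_matrix_unitary V (theta : 'I_N -> R) (alpha : R) :
  V \is unitarymx -> fractional_matrix V theta alpha \is unitarymx.
Proof.
move=> V_unitary; rewrite /fractional_matrix.
apply: mul_unitarymx; last by rewrite trmxC_unitary.
apply: mul_unitarymx => //; apply/unitarymxP.
rewrite tr_diag_mx map_diag_mx mulmx_diag; apply/matrixP => i j.
by rewrite !mxE expi_mul_conj.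
Qed.

Lemma hermitian_dot_unitary U u v :
  U \is unitarymx -> hermitian_dot (U *m u) (U *m v) = hermitian_dot u v.
Proof.
move=> U_unitary; rewrite /hermitian_dot trmx_mul map_mxM.
by rewrite [_ *m (U *m v)]mulmxA mulmxKtV.
Qed.

Lemma hermitian_dot_complexify (x y : 'cV[R]_N) :
  hermitian_dot (complexify x) (complexify y) = ((x^T *m y) 0 0)%:C.
Proof.
rewrite /hermitian_dot !mxE rmorph_sum; apply: eq_bigr => i _ /=.
rewrite !mxE rmorphM /=; congr (_ * _); exact: conjc_real.
Qed.

(** Stated over the complex numbers so that, by injectivity of the embedding of
    the reals, a Hermitian identity yields one between real norms. *)
Lemma hermitian_dot_self u : hermitian_dot u u = (l2norm u ^+ 2)%:C.
Proof.
rewrite /l2norm sqr_sqrtr; last by apply: sumr_ge0 => i _; apply: sqr_ge0.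
rewrite /hermitian_dot mxE rmorph_sum; apply: eq_bigr => i _ /=.
by rewrite !mxE rmorphXn /= mulrC -normCK.
Qed.

End Hermitian.

Section MassProduct.
Variables (R : realType) (N : nat) (b : 'I_N -> R).

Lemma sqrt_mass_matrix_sqr : (forall i, 0 <= b i) ->
  sqrt_mass_matrix b *m sqrt_mass_matrix b = mass_matrix b.
Proof.
move=> b_ge0; rewrite mulmx_diag; congr diag_mx.
by apply/rowP => i; rewrite !mxE -expr2 sqr_sqrtr.
Qed.

Lemma sqrt_mass_dot (f g : 'cV[R]_N) : (forall i, 0 <= b i) ->
  ((sqrt_mass_matrix b *m f)^T *m (sqrt_mass_matrix b *m g)) 0 0
    = mass_dot b f g.
Proof.
move=> b_ge0; rewrite /mass_dot -(sqrt_mass_matrix_sqr b_ge0) trmx_mul.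
by rewrite tr_diag_mx !mulmxA.
Qed.

(** The unitary factor cancels, leaving the real vectors [B^(1/2) f] and
    [B^(1/2) g], whose dot product is [f^T B g]. *)
Lemma pmfht_parseval V (theta : 'I_N -> R) (alpha : R) (f g : 'cV[R]_N) :
  (forall i, 0 <= b i) -> V \is unitarymx ->
  hermitian_dot (pmfht b V theta alpha f) (pmfht b V theta alpha g)
    = (mass_dot b f g)%:C.
Proof.
move=> b_ge0 V_unitary.
rewrite hermitian_dot_unitary; last exact: fractional_matrix_unitary.
by rewrite hermitian_dot_complexify sqrt_mass_dot.
Qed.

End MassProduct.

Theorem theorem1 (R : realType) (N : nat)
  (* point cloud and time parameter *)
  (p : 'I_N -> 'rV[R]_3) (p_inj : injective p)
  (t : R) (t_gt0 : 0 < t)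
  (* estimated tangent planes *)
  (r : 'I_N -> R) (r_gt0 : forall i, 0 < r i)
  (T : 'I_N -> plane R) (T_fit : forall i, best_fitting p i (r i) (T i))
  (* Voronoi areas *)
  (delta : R) (delta_gt0 : 0 < delta)
  (b : 'I_N -> R) (b_area : forall i, voronoi_area p i delta (T i) = (b i)%:E)
  (b_gt0 : forall i, 0 < b i)
  (* generalized eigenvectors, normalized *)
  (H : 'M[R]_N) (lambda : 'I_N -> R)
  (H_eigen : forall i, lb_matrix p t b *m col i H
                       = - lambda i *: (mass_matrix b *m col i H))
  (H_norm : H^T *m mass_matrix b *m H = 1%:M)
  (* spectral decomposition, with a choice of arguments of the eigenvalues *)
  (V : 'M[R[i]]_N) (V_unitary : V \is unitarymx)
  (omega : 'I_N -> R[i]) (omega_norm : forall i, `|omega i| = 1)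
  (F_spectral : complexify (harmonic_matrix b H)
                = V *m diag_mx (\row_i omega i) *m V ^t*)
  (theta : 'I_N -> R) (theta_arg : forall i, omega i = expi (theta i))
  (f g : 'cV[R]_N) (alpha : R) :
  hermitian_dot (pmfht b V theta alpha f) (pmfht b V theta alpha g)
    = (mass_dot b f g)%:C
  /\ l2norm (pmfht b V theta alpha f) ^+ 2 = (f^T *m mass_matrix b *m f) 0 0.
Proof.
have parseval u v := pmfht_parseval theta alpha u v (fun i => ltW (b_gt0 i))
  V_unitary.
split; first exact: parseval.
by apply: (@complexI R); rewrite -hermitian_dot_self parseval.
Qed.
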